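(* Let $\eta\in\mathbb C\setminus\{0\}$ and $2\lambda_1,2\lambda_2\in\mathbb N_0$. Consider the operator $F_{12}^{-1}$ on $V_{\lambda_1}(\delta_1)\otimes V_{\lambda_2}(\delta_2)$, $$F_{12}^{-1}=\Bigl(\sum_{n\ge0}\tfrac{(-\eta)^n}{n!}\,F^n\otimes E^n\prod_{j=1}^n\bigl(\delta_1-\delta_2+\eta(H\otimes1-1\otimes H)-\eta j\bigr)^{-1}\Bigr)Q_{12}^{-1},\qquad Q_{12}^{-1}|\ell,k\rangle=\prod_{j=0}^{k-1}\frac{\delta_1-\delta_2+\eta(\lambda_1-\lambda_2-\ell+j)}{\delta_1-\delta_2+\eta(-\lambda_1-\lambda_2+j)}\,|\ell,k\rangle,$$ whose matrix coefficients are regarded as rational functions of $\delta_1-\delta_2$ (with common factors cancelled). Then $F_{12}^{-1}$ is well-defined (its matrix coefficients have no pole) for all values $\delta_1,\delta_2\in\mathbb C$ such that the finite-dimensional representation $V_{\lambda_1}(\delta_1)\otimes V_{\lambda_2}(\delta_2)$ of the Yangian is irreducible.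
   Context: For $2\lambda\in\mathbb N_0$, $V_\lambda$ is the $(2\lambda+1)$-dimensional irreducible $\mathfrak{sl}_2$-representation with basis $|k\rangle$, $0\le k\le2\lambda$, $H|k\rangle=(\lambda-k)|k\rangle$, $E|k\rangle=k|k-1\rangle$, $F|k\rangle=(2\lambda-k)|k+1\rangle$. $|\ell,k\rangle=|\ell\rangle\otimes|k\rangle$ is the basis of $V_{\lambda_1}\otimes V_{\lambda_2}$ in which matrix coefficients are taken. The evaluation representation $V_\lambda(\delta)$ of the Yangian is $V_\lambda$ with operators ($u\in\mathbb C$) $A(u)=u-\delta+\eta H$, $B(u)=\eta F$, $C(u)=\eta E$, $D(u)=u-\delta-\eta H$; the tensor product $V_{\lambda_1}(\delta_1)\otimes V_{\lambda_2}(\delta_2)$ is a representation via $\Delta A=A\otimes A+C\otimes B$, $\Delta B=B\otimes A+D\otimes B$, $\Delta C=A\otimes C+C\otimes D$, $\Delta D=B\otimes C+D\otimes D$. It is irreducible if no proper nonzero subspace is invariant under all $\Delta A(u),\Delta B(u),\Delta C(u),\Delta D(u)$, $u\in\mathbb C$. In $F_{12}^{-1}$, the $n$-th term is zero on $|\ell,k\rangle$ if $F^n\otimes E^n|\ell,k\rangle=0$. *)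

(* Defs.v *)
From HB Require Import structures.
From mathcomp Require Import all_boot all_order all_algebra.
From mathcomp Require Import fraction complex mxtens reals.

Set Implicit Arguments.
Unset Strict Implicit.
Unset Printing Implicit Defensive.

Import GRing.Theory.
Local Open Scope ring_scope.

Notation "x %:F" := (@FracField.tofrac _ x) : ring_scope.

(* V_lambda is encoded by the natural number m = 2 lambda; its operators are
   (m + 1) x (m + 1) matrices acting on column vectors: the entry (i, k) is the
   coefficient of |i> in the image of |k>. *)
Section Sl2.
Variables (K : fieldType) (m : nat).

Definition spin : K := m%:R / 2%:R.

Definition sl2H : 'M[K]_m.+1 :=
  \matrix_(i, k) if i == k then spin - k%:R else 0.

Definition sl2E : 'M[K]_m.+1 :=
  \matrix_(i, k) if k == i.+1 :> nat then k%:R else 0.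

Definition sl2F : 'M[K]_m.+1 :=
  \matrix_(i, k) if i == k.+1 :> nat then m%:R - k%:R else 0.

Lemma sl2E_exp0 n : (m < n)%N -> sl2E ^+ n = 0.
Proof.
move=> lt_mn; have E0 p (i k : 'I_m.+1) :
    (k < i + p)%N -> (sl2E ^+ p) i k = 0.
  elim: p i k => [|p IHp] i k lt_k.
    rewrite expr0 mxE; case: eqP => // eq_ik.
    by move: lt_k; rewrite addn0 eq_ik ltnn.
  rewrite exprS mxE big1 // => j _; rewrite mxE.
  case: eqP => [eq_j|_]; last by rewrite mul0r.
  by rewrite IHp ?mulr0 // eq_j addSnnS.
apply/matrixP => i k; rewrite E0 ?mxE //.
by rewrite (leq_trans (ltn_ord k)) // (leq_trans lt_mn) ?leq_addl.
Qed.

Variables (eta delta : K).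

Definition evA (u : K) : 'M[K]_m.+1 := (u - delta)%:M + eta *: sl2H.
Definition evB (u : K) : 'M[K]_m.+1 := eta *: sl2F.
Definition evC (u : K) : 'M[K]_m.+1 := eta *: sl2E.
Definition evD (u : K) : 'M[K]_m.+1 := (u - delta)%:M - eta *: sl2H.

End Sl2.

(* The basis vector |l,k> of the tensor product has index mxtens_index (l, k). *)
Section Tensor.
Variables (K : fieldType) (eta : K) (m1 m2 : nat) (delta1 delta2 : K).

Local Notation A1 := (evA m1 eta delta1).
Local Notation B1 := (evB m1 eta).
Local Notation C1 := (evC m1 eta).
Local Notation D1 := (evD m1 eta delta1).
Local Notation A2 := (evA m2 eta delta2).
Local Notation B2 := (evB m2 eta).
Local Notation C2 := (evC m2 eta).
Local Notation D2 := (evD m2 eta delta2).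
Local Notation op := 'M[K]_(m1.+1 * m2.+1).

Definition tensA (u : K) : op := A1 u *t A2 u + C1 u *t B2 u.
Definition tensB (u : K) : op := B1 u *t A2 u + D1 u *t B2 u.
Definition tensC (u : K) : op := A1 u *t C2 u + C1 u *t D2 u.
Definition tensD (u : K) : op := B1 u *t C2 u + D1 u *t D2 u.

Definition stable_under (M : op) (U : {vspace 'cV[K]_(m1.+1 * m2.+1)}) : Prop :=
  forall v, v \in U -> M *m v \in U.

Definition yangian_irreducible : Prop :=
  forall U : {vspace 'cV[K]_(m1.+1 * m2.+1)},
    (forall u, [/\ stable_under (tensA u) U, stable_under (tensB u) U,
                   stable_under (tensC u) U & stable_under (tensD u) U]) ->
    U = 0%VS \/ U = fullv.

End Tensor.

Section Twist.
Variables (C : fieldType) (eta : C) (m1 m2 : nat).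

(* The indeterminate x stands for delta1 - delta2. *)
Local Notation K := {fraction {poly C}}.
Local Notation x := ('X%:F : K).
Local Notation h := (eta%:P%:F : K).
Local Notation op := 'M[K]_(m1.+1 * m2.+1).

Definition Qinv_coef (l k : nat) : K :=
  \prod_(j < k) ((x + h * (spin K m1 - spin K m2 - l%:R + j%:R)) /
                 (x + h * (- spin K m1 - spin K m2 + j%:R))).

Definition Qinv : op :=
  diag_mx (\row_i Qinv_coef (mxtens_unindex i).1 (mxtens_unindex i).2).

(* Diagonal with entries x + c, c constant, hence invertible over C(x). *)
Definition Finv_factor (j : nat) : op :=
  x%:M + h *: (sl2H K m1 *t 1%:M - 1%:M *t sl2H K m2) - (h * j%:R)%:M.

Definition Finv_term (n : nat) : op :=
  ((- h) ^+ n / (n`!)%:R) *: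
    (((sl2F K m1 ^+ n) *t (sl2E K m2 ^+ n)) *m
     \prod_(1 <= j < n.+1) invmx (Finv_factor j)).

(* The terms with n > m2 vanish, since then E^n = 0 on the second factor
   (sl2E_exp0). *)
Definition Finv : op := (\sum_(n < m2.+1) Finv_term n) *m Qinv.

End Twist.

(* In lowest terms, the denominator of r does not vanish at a. *)
Definition no_pole (C : fieldType) (r : {fraction {poly C}}) (a : C) : Prop :=
  exists p q : {poly C}, [/\ coprimep p q, r = p%:F / q%:F & ~~ root q a].

(* Main.v *)
(* On |l,k>, the n-th term of the twist has the coefficient, up to a constant,
     prod_(j < k - n) (x + eta (lambda1 - lambda2 - l + j)) /
     prod_(j < k) (x + eta (- lambda1 - lambda2 + j)),
   because the inverted Cartan factors cancel the top n factors of the numerator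
   of Q.  The poles with j >= 2 lambda1 cancel against the numerator whenever
   F^n |l> <> 0; the others are at x = eta (lambda1 + lambda2 - j) with
   j < 2 lambda1 and j < 2 lambda2.  There the representation is reducible:
   identify |l,k> with the monomial a^l b^k; the polynomials divisible by
   (a - b)^(j+1) form a proper nonzero subspace that is invariant. *)
Require Import Defs.
From mathcomp Require Import all_boot all_order all_algebra.
From mathcomp Require Import fraction complex mxtens reals.
From mathcomp Require Import ring zify.
Import GRing.Theory Num.Theory.
Local Open Scope ring_scope.

Set Implicit Arguments.
Unset Strict Implicit.
Unset Printing Implicit Defensive.

Definition tens_row (T : Type) (m1 m2 : nat) (g : nat -> nat -> T) :
    'rV[T]_(m1.+1 * m2.+1) :=
  \row_q g (mxtens_unindex q).1 (mxtens_unindex q).2.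
Arguments tens_row {T m1 m2} g.

Lemma tens_rowE (T : Type) m1 m2 (g : nat -> nat -> T)
    (l : 'I_m1.+1) (k : 'I_m2.+1) :
  tens_row g 0 (mxtens_index (l, k)) = g l k.
Proof. by rewrite mxE mxtens_indexK. Qed.

(** * The Yangian action on Taylor coefficients along the diagonal *)

Section Reducibility.
Variables (C : numFieldType) (eta : C).

(** Matrices act from the right on linear forms. Since [g] lives on all of [nat], no index bound is
    needed: in [shift_evB] and [shift_evC] the coefficient vanishes at the boundary, where the shift
    would leave the basis. *)
Definition shift_op m (X : 'M[C]_m.+1) (c : nat -> C) (s : nat -> nat) : Prop :=
  forall (g : nat -> C) (k : 'I_m.+1),
    \sum_(l < m.+1) g l * X l k = c k * g (s k).

Lemma shift_diag m (X : 'M[C]_m.+1) (c : nat -> C) :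
  (forall i k : 'I_m.+1, X i k = if i == k then c k else 0) -> shift_op X c id.
Proof.
move=> XE g k; rewrite (bigD1 k) //= XE eqxx mulrC big1 ?addr0 // => i neq_ik.
by rewrite XE (negPf neq_ik) mulr0.
Qed.

Lemma shift_evA m d u :
  shift_op (evA m eta d u) (fun k => u - d + eta * (spin C m - k%:R)) id.
Proof.
apply: shift_diag => i k; rewrite !mxE.
by case: (i =P k) => _; rewrite ?mulr1n ?mulr0n ?mulr0 ?addr0.
Qed.

Lemma shift_evD m d u :
  shift_op (evD m eta d u) (fun k => u - d - eta * (spin C m - k%:R)) id.
Proof.
apply: shift_diag => i k; rewrite !mxE.
by case: (i =P k) => _; rewrite ?mulr1n ?mulr0n ?mulr0 ?subr0.
Qed.

Lemma shift_evB m u :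
  shift_op (evB m eta u) (fun k => eta * (m%:R - k%:R)) succn.
Proof.
move=> g k; case: (ltnP k.+1 m.+1) => [lt_k|le_mk].
  rewrite (bigD1 (Ordinal lt_k)) //= !mxE eqxx mulrC big1 ?addr0 // => i.
  rewrite -val_eqE /= !mxE => /negPf->.
  by rewrite !mulr0.
rewrite big1 => [|i _].
  have -> : k = m :> nat by apply/anti_leq; rewrite -ltnS ltn_ord.
  by rewrite subrr mulr0 mul0r.
rewrite !mxE; case: eqP => [eq_i|_]; last by rewrite !mulr0.
by move: (ltn_ord i); rewrite eq_i ltnNge le_mk.
Qed.

Lemma shift_evC m u :
  shift_op (evC m eta u) (fun k => eta * k%:R) predn.
Proof.
move=> g k; case: (posnP k) => [k0|k_gt0].
  rewrite k0 mulr0 mul0r big1 // => i _.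
  by rewrite !mxE k0 /= !mulr0.
have lt_k : (k.-1 < m.+1)%N by rewrite (leq_ltn_trans (leq_pred k)).
rewrite (bigD1 (Ordinal lt_k)) //= !mxE /= prednK // eqxx mulrC big1 ?addr0 // => i.
rewrite -val_eqE /= !mxE; case: (k =P i.+1 :> nat) => [->|_]; last by rewrite !mulr0.
by rewrite eqxx.
Qed.

Variables (m1 m2 : nat).

Lemma sum_mxtens (V : nmodType) (f : 'I_(m1.+1 * m2.+1) -> V) :
  \sum_q f q = \sum_l \sum_k f (mxtens_index (l, k)).
Proof.
rewrite pair_big /= (reindex (@mxtens_index m1.+1 m2.+1)) /=.
  by apply: eq_bigr => -[].
by exists (@mxtens_unindex _ _) => i _; rewrite ?mxtens_indexK ?mxtens_unindexK.
Qed.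

Lemma tens_row_mul g X Y c d s t :
  shift_op X c s -> shift_op Y d t ->
  (tens_row g : 'rV_(m1.+1 * m2.+1)) *m (X *t Y) =
    tens_row (fun l k => c l * d k * g (s l) (t k)).
Proof.
move=> shX shY; apply/rowP => q; case: (mxtens_indexP q) => l k.
rewrite tens_rowE mxE sum_mxtens.
transitivity (\sum_(l' < m1.+1) d k * g l' (t k) * X l' l).
  apply: eq_bigr => l' _; rewrite -(shY (g l')) mulr_suml.
  by apply: eq_bigr => k' _; rewrite tens_rowE tensmxE; ring.
by rewrite (shX (fun l' => d k * g l' (t k))); ring.
Qed.

(* The linear form [diag_row i d] extracts, from the polynomial
   sum v_(l,k) a^l b^k, the coefficient of degree d - i in b of its i-th Taylor
   coefficient in a along the diagonal a = b. *)
Definition diag_entry (i d l k : nat) : C :=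
  if (l + k == d)%N then 'C(l, i)%:R else 0.

Definition diag_row (i d : nat) : 'rV[C]_(m1.+1 * m2.+1) :=
  tens_row (diag_entry i d).

Variables (delta1 delta2 : C).
Local Notation x := (delta1 - delta2).
Local Notation w i := (eta * (spin C m1 + spin C m2 - i%:R) - x).

(* At x = eta (lambda1 + lambda2 - i) the form of order i + 1 drops out. *)
Definition lowers_diag_row (M : 'M[C]_(m1.+1 * m2.+1)) : Prop :=
  forall i d, exists d' a b c,
    diag_row i d *m M =
      a *: diag_row i d' + (b * w i) *: diag_row i.+1 d' + c *: diag_row i.-1 d'.

(** The main reduction rule: a factor [l - i] turns the form of order [i] into the one of order
    [i.+1], so coefficients polynomial in [l] can be expanded around [l = i]. *)
Lemma bin_mulS l i : i.+1%:R * 'C(l, i.+1)%:R = (l%:R - i%:R) * 'C(l, i)%:R :> C.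
Proof.
rewrite -natrM mul_bin_left; case: (leqP i l) => [le_il|lt_li].
  by rewrite natrM natrB.
by rewrite bin_small // muln0 mulr0.
Qed.

Lemma bin_mulP l i : l%:R * 'C(l.-1, i)%:R = (l%:R - i%:R) * 'C(l, i)%:R :> C.
Proof. by rewrite -bin_mulS -!natrM mul_bin_diag. Qed.

Lemma spin2 m : m%:R = 2%:R * spin C m.
Proof. by rewrite /spin mulrC divfK // pnatr_eq0. Qed.

(** Linear certificates: the multiplier [e] says how often a known identity is used, and [ring]
    checks the remainder. *)
Lemma eq_from_multiple (e a b p q : C) :
  a = b -> p - q = e * (a - b) -> p = q.
Proof. by move=> -> /eqP; rewrite subrr mulr0 subr_eq0 => /eqP. Qed.

Lemma diag_entry_predl i d l k :
  l%:R * diag_entry i d l.-1 k = (l%:R - i%:R) * diag_entry i d.+1 l k.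
Proof.
rewrite /diag_entry; case: l => [|l].
  have := bin_mulP 0 i; rewrite !mul0r => E.
  by case: ifP; rewrite ?mulr0.
by rewrite /= addSn eqSS; case: ifP; rewrite ?mulr0 // -bin_mulP.
Qed.

Lemma diag_entry_succr i d l k : diag_entry i d.+1 l k.+1 = diag_entry i d l k.
Proof. by rewrite /diag_entry addnS eqSS. Qed.

Lemma diag_entry_predr i d l k :
  k%:R * diag_entry i d l k.-1 = k%:R * diag_entry i d.+1 l k.
Proof. by case: k => [|k]; rewrite ?mul0r // diag_entry_succr. Qed.

Lemma lowers_tensA u : lowers_diag_row (tensA eta m1 m2 delta1 delta2 u).
Proof.
(* With [k = d - l], the total coefficient of C(l,i) is a polynomial P in [l] whose quadratic terms
   cancel, and P(l) = P(i) + eta w_i (l - i). The first witness is P(i); [bin_mulS] turns the rest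
   into the form of order [i.+1]. *)
move=> i d; exists d,
  ((u - delta1 + eta * (spin C m1 - i%:R)) *
   (u - delta2 + eta * (spin C m2 - d%:R + i%:R))), (eta * i.+1%:R), 0.
rewrite mulmxDr (tens_row_mul _ (@shift_evA _ _ _) (@shift_evA _ _ _)).
rewrite (tens_row_mul _ (@shift_evC _ _) (@shift_evB _ _)).
apply/rowP => q; case: (mxtens_indexP q) => l k; rewrite !mxE !mxtens_indexK /=.
have E := diag_entry_predl i d l k.+1; rewrite diag_entry_succr in E.
apply: (eq_from_multiple (e := eta * (eta * (m2%:R - k%:R))) E) => {E}.
rewrite /diag_entry; case: (l + k =P d)%N => [<-|_]; last by ring.
apply: (eq_from_multiple (e := - eta * w i) (bin_mulS l i)).
by rewrite natrD (spin2 m2); ring.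
Qed.

Lemma lowers_tensC u : lowers_diag_row (tensC eta m1 m2 delta1 delta2 u).
Proof.
(* The same expansion with [k = d.+1 - l]; here the slope is - eta w_i. *)
move=> i d; exists d.+1,
  (eta * (d.+1%:R - i%:R) * (u - delta1 + eta * (spin C m1 - i%:R))),
  (- eta * i.+1%:R), 0.
rewrite mulmxDr (tens_row_mul _ (@shift_evA _ _ _) (@shift_evC _ _)).
rewrite (tens_row_mul _ (@shift_evC _ _) (@shift_evD _ _ _)).
apply/rowP => q; case: (mxtens_indexP q) => l k; rewrite !mxE !mxtens_indexK /=.
apply: (eq_from_multiple (e := eta * (u - delta2 - eta * (spin C m2 - k%:R)))
  (diag_entry_predl i d l k)).
apply: (eq_from_multiple (e := eta * (u - delta1 + eta * (spin C m1 - l%:R)))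
  (diag_entry_predr i d l k)).
rewrite /diag_entry; case: (l + k =P d.+1)%N => [<-|_]; last by ring.
apply: (eq_from_multiple (e := eta * w i) (bin_mulS l i)).
by rewrite natrD; ring.
Qed.

Lemma lowers_tensD u : lowers_diag_row (tensD eta m1 m2 delta1 delta2 u).
Proof.
move=> i d.
(* On [l + k = d], [q3] comes from B ⊗ C (up to eta^2) and [q4] from D ⊗ D. The shift of [l] in B ⊗
   C gives C(l+1,i) = C(l,i) + C(l,i-1), whence a form of order [i.-1]. Expanding [q3] around
   [i - 1] yields its coefficient and the correction with factor [i] in the first witness. *)
pose q3 l : C := (m1%:R - l) * (d%:R - l).
pose q4 l : C := (u - delta1 - eta * (spin C m1 - l)) *
   (u - delta2 - eta * (spin C m2 - d%:R + l)).
exists d, (eta ^+ 2 * q3 i%:R + q4 i%:R +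
    i%:R * eta ^+ 2 * (i%:R + i.-1%:R - m1%:R - d%:R)),
  (- eta * i.+1%:R), (eta ^+ 2 * (if i == 0%N then 0 else q3 (i.-1%:R))).
rewrite mulmxDr (tens_row_mul _ (@shift_evD _ _ _) (@shift_evD _ _ _)).
rewrite (tens_row_mul _ (@shift_evB _ _) (@shift_evC _ _)).
apply/rowP => q; case: (mxtens_indexP q) => l k; rewrite !mxE !mxtens_indexK /=.
apply: (eq_from_multiple (e := eta * (eta * (m1%:R - l%:R)))
  (diag_entry_predr i d l.+1 k)).
rewrite /diag_entry addSn eqSS; case: (l + k =P d)%N => [dE|_]; last by ring.
case: i => [|i] /=.
  apply: (eq_from_multiple (e := eta * w 0) (bin_mulS l 0)).
  by rewrite !bin0 /q3 /q4 -dE natrD (spin2 m1); ring.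
apply: (eq_from_multiple (e := eta * w i.+1) (bin_mulS l i.+1)).
apply: (eq_from_multiple (e := - eta ^+ 2 * (l%:R + i%:R - m1%:R - d%:R))
  (bin_mulS l i)).
by rewrite binS /q3 /q4 -dE !natrD (spin2 m1); ring.
Qed.

Lemma lowers_tensB u : lowers_diag_row (tensB eta m1 m2 delta1 delta2 u).
Proof.
move=> i d.
rewrite mulmxDr (tens_row_mul _ (@shift_evB _ _) (@shift_evA _ _ _)).
rewrite (tens_row_mul _ (@shift_evD _ _ _) (@shift_evB _ _)).
(* F raises the degree [l + k], so the image has no component of degree 0. *)
case: d => [|d].
  exists 0, 0, 0, 0.
  by apply/rowP => q; rewrite !mxE /diag_entry addnS addSn /=; ring.
(* [q1] comes from B ⊗ A and [q2] from D ⊗ B, up to eta. Only the former shifts [l], so Pascal's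
   rule is applied to [q1] alone. *)
pose q1 l : C := (m1%:R - l) * (u - delta2 + eta * (spin C m2 - d%:R + l)).
pose q2 l : C := (u - delta1 - eta * (spin C m1 - l)) * (m2%:R - d%:R + l).
exists d, (eta * (q1 i%:R + q2 i%:R + i%:R *
    (m1%:R * eta - (u - delta2 + eta * (spin C m2 - d%:R)) -
     eta * (i%:R + i.-1%:R)))),
  (eta * i.+1%:R), (eta * (if i == 0%N then 0 else q1 (i.-1%:R))).
apply/rowP => q; case: (mxtens_indexP q) => l k; rewrite !mxE !mxtens_indexK /=.
rewrite diag_entry_succr /diag_entry addSn eqSS.
case: (l + k =P d)%N => [dE|_]; last by ring.
case: i => [|i] /=.
  apply: (eq_from_multiple (e := - eta * w 0) (bin_mulS l 0)).
  by rewrite !bin0 /q1 /q2 -dE natrD (spin2 m1) (spin2 m2); ring.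
apply: (eq_from_multiple (e := - eta * w i.+1) (bin_mulS l i.+1)).
apply: (eq_from_multiple (e := - eta * (m1%:R * eta -
  (u - delta2 + eta * (spin C m2 - d%:R)) - eta * (l%:R + i%:R))) (bin_mulS l i)).
by rewrite binS /q1 /q2 -dE !natrD (spin2 m1) (spin2 m2); ring.
Qed.
End Reducibility.

(** * The invariant subspace at the exceptional parameters *)

Section Reducible.
Variables (C : numFieldType) (eta : C).
Variables (m1 m2 : nat).
Local Notation diag_row := (diag_row C m1 m2).

Definition jet_mx (p : nat) : 'M[C]_(p * (m1 + m2).+1, m1.+1 * m2.+1) :=
  \matrix_q diag_row (mxtens_unindex q).1 (mxtens_unindex q).2.

(* Membership in this kernel means divisibility by (a - b)^p; forms of degree
   d > m1 + m2 vanish (diag_row_large). *)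
Definition jet_kernel (p : nat) : {vspace 'cV[C]_(m1.+1 * m2.+1)} :=
  lker (linfun (mulmx (jet_mx p))).

Lemma diag_row_large i d : (m1 + m2 < d)%N -> diag_row i d = 0.
Proof.
move=> lt_d; apply/rowP => q; case: (mxtens_indexP q) => l k.
rewrite !mxE mxtens_indexK /= /diag_entry; case: eqP => // eq_d.
by move: lt_d; rewrite -eq_d ltnNge leq_add // -ltnS.
Qed.

Lemma jet_kernelP p v :
  reflect (forall i d, (i < p)%N -> diag_row i d *m v = 0) (v \in jet_kernel p).
Proof.
rewrite memv_ker lfunE /=; apply: (iffP eqP) => [v0 i d lt_ip | v0].
  case: (ltnP d (m1 + m2).+1) => [lt_d|]; last first.
    by move/(diag_row_large i) ->; rewrite mul0mx.
  have := congr1 (row (mxtens_index (Ordinal lt_ip, Ordinal lt_d))) v0.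
  by rewrite row_mul rowK mxtens_indexK row0.
by apply/row_matrixP => q; rewrite row_mul rowK row0 v0.
Qed.

(** Orders change by at most one, so only [i = j] could produce a form of order above [j]; its
    coefficient contains w_j, which is zero here. *)
Lemma jet_kernel_stable delta1 delta2 j M :
  delta1 - delta2 = eta * (spin C m1 + spin C m2 - j%:R) ->
  lowers_diag_row eta delta1 delta2 M -> stable_under M (jet_kernel j.+1).
Proof.
move=> xE lowM v /jet_kernelP v0; apply/jet_kernelP => i d lt_ij.
rewrite mulmxA; have [d' [a [b [c ->]]]] := lowM i d.
rewrite !mulmxDl -!scalemxAl v0 // (v0 i.-1) ?(leq_ltn_trans (leq_pred i)) //.
rewrite !scaler0 addr0 add0r; move: lt_ij; rewrite leq_eqVlt eqSS.
case/predU1P => [->|lt_ij]; last by rewrite v0 ?scaler0.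
by rewrite xE subrr mulr0 scale0r.
Qed.

(** The constant polynomial 1 is not divisible by a - b. *)
Lemma jet_kernel_neq_full p : jet_kernel p.+1 != fullv.
Proof.
pose e : 'cV[C]_(m1.+1 * m2.+1) := delta_mx (mxtens_index (ord0, ord0)) 0.
apply/eqP => U_full; have := memvf e.
rewrite -U_full => /jet_kernelP /(_ 0 0 isT)%N /rowP /(_ 0).
rewrite -colE !mxE mxtens_indexK /= /diag_entry /= bin0 => /eqP.
by rewrite oner_eq0.
Qed.

(** Compare the coefficients of X^i in (1 - (X + 1))^p = (-X)^p. *)
Lemma alternating_bin_sum p i : (i < p)%N ->
  \sum_(l < p.+1) 'C(l, i)%:R * ((- 1) ^+ l * 'C(p, l)%:R) = 0 :> C.
Proof.
move=> lt_ip.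
have coefX1 l : (('X + 1 : {poly C}) ^+ l)`_i = 'C(l, i)%:R.
  rewrite exprD1n coef_sum; under eq_bigr do rewrite coefMn coefXn.
  case: (ltnP i l.+1) => [lt_il|lt_li].
    rewrite (bigD1 (Ordinal lt_il)) //= eqxx big1 ?addr0 // => j.
    by rewrite -val_eqE eq_sym => /negPf ->; rewrite mul0rn.
  rewrite bin_small // big1 // => j _; case: eqP => [eq_ij|_]; rewrite ?mul0rn //.
  by move: (ltn_ord j); rewrite -eq_ij ltnNge lt_li.
have := exprBn 1 ('X + 1 : {poly C}) p.
rewrite opprD addrCA subrr addr0 exprNn => /(congr1 (fun q : {poly C} => q`_i)).
rewrite -signr_odd mulr_sign.
have -> : (if odd p then - 'X^p else 'X^p : {poly C})`_i = 0.
  by case: ifP; rewrite ?coefN coefXn ltn_eqF ?oppr0.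
rewrite coef_sum => /esym sum0; rewrite -[RHS]sum0; apply: eq_bigr => l _.
have sgnE : (- 1) ^+ l = ((- 1) ^+ l)%:P :> {poly C} by rewrite rmorphXn rmorphN1.
by rewrite expr1n mulr1 sgnE coefMn coefCM coefX1 -mulr_natr; ring.
Qed.

(** The power (b - a)^p has degree [p] in each variable, so the two bounds let it fit into the
    tensor product. *)
Lemma jet_kernel_neq0 p : (p <= m1)%N -> (p <= m2)%N -> jet_kernel p != 0%VS.
Proof.
move=> le_pm1 le_pm2.
(* The coefficients of (b - a)^p. *)
pose f (l k : nat) : C := if (l + k == p)%N then (- 1) ^+ l * 'C(p, l)%:R else 0.
pose v : 'cV[C]_(m1.+1 * m2.+1) := (tens_row f)^T.
have v_in : v \in jet_kernel p.
  apply/jet_kernelP => i d lt_ip; apply/matrixP => a b; rewrite !ord1 !mxE.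
  rewrite sum_mxtens.
  have [->|neq_dp] := eqVneq d p; last first.
    rewrite big1 // => l _; rewrite big1 // => k _.
    rewrite !mxE mxtens_indexK /= /diag_entry /f.
    case: eqP => [eq_d|_]; last by rewrite mul0r.
    by rewrite eq_d (negPf neq_dp) mulr0.
  pose g l : C := 'C(l, i)%:R * ((- 1) ^+ l * 'C(p, l)%:R).
  transitivity (\sum_(l < m1.+1) g l).
    apply: eq_bigr => l _; case: (leqP l p) => [le_lp|lt_pl]; last first.
      rewrite /g (bin_small lt_pl) !mulr0 big1 // => k _.
      rewrite !mxE mxtens_indexK /= /diag_entry /f (bin_small lt_pl) mulr0.
      by rewrite if_same mulr0.
    (* For fixed [l] only [k = p - l] contributes. *)
    have lt_k : (p - l < m2.+1)%N by rewrite ltnS (leq_trans (leq_subr _ _)).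
    rewrite (bigD1 (Ordinal lt_k)) //= !mxE mxtens_indexK /= /diag_entry /f.
    rewrite subnKC // eqxx big1 ?addr0 // => k; rewrite -val_eqE /= => neq_k.
    rewrite !mxE mxtens_indexK /= /diag_entry.
    case: eqP => [eq_p|_]; last by rewrite mul0r.
    by move: neq_k; rewrite -eq_p addKn eqxx.
  rewrite -[RHS](alternating_bin_sum lt_ip) -!(big_mkord xpredT g).
  rewrite (big_cat_nat (n := p.+1)) //= [X in _ + X]big_nat [X in _ + X]big1 ?addr0 // => l.
  by case/andP => lt_pl _; rewrite /g (bin_small lt_pl) !mulr0.
apply/eqP => U0; move: v_in; rewrite U0 memv0 => /eqP /colP.
(* The coefficient of b^p is 1. *)
move=> /(_ (mxtens_index (ord0, inord p))).
rewrite !mxE mxtens_indexK /= /f inordK // eqxx bin0 expr0 mulr1 => /eqP.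
by rewrite oner_eq0.
Qed.

Lemma irreducible_neq (delta1 delta2 : C) j :
  yangian_irreducible eta m1 m2 delta1 delta2 -> (j < m1)%N -> (j < m2)%N ->
  delta1 - delta2 != eta * (spin C m1 + spin C m2 - j%:R).
Proof.
move=> irr lt_jm1 lt_jm2; apply/eqP => xE.
case: (irr (jet_kernel j.+1)) => [u|U0|Ufull].
- by split; apply: jet_kernel_stable xE _;
    [apply: lowers_tensA | apply: lowers_tensB |
     apply: lowers_tensC | apply: lowers_tensD].
- by case/eqP: (jet_kernel_neq0 lt_jm1 lt_jm2).
- by case/eqP: (jet_kernel_neq_full j).
Qed.
End Reducible.

(** * The local ring of rational functions regular at a point *)

Section Regular.
Variables (C : fieldType) (a : C).
Local Notation K := {fraction {poly C}}.

(** Coprimality is dropped from [no_pole], which makes closure under sums and products immediate. *)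
Definition regular_at (r : K) : Prop :=
  exists p q : {poly C}, r = p%:F / q%:F /\ ~~ root q a.

Lemma root_neq0 (q : {poly C}) : ~~ root q a -> q%:F != 0 :> K.
Proof. by rewrite tofrac_eq0; apply: contraNneq => ->; rewrite root0. Qed.

(** After division by the gcd, the new denominator divides the old one, so it still does not vanish
    at [a]. *)
Lemma regular_no_pole r : regular_at r -> no_pole r a.
Proof.
case=> p [q [-> q_a]]; have q0 := root_neq0 q_a; rewrite tofrac_eq0 in q0.
have g0 : gcdp p q != 0 by rewrite gcdp_eq0 (negPf q0) andbF.
have dp := divpK (dvdp_gcdl p q); have dq := divpK (dvdp_gcdr p q).
exists (p %/ gcdp p q), (q %/ gcdp p q); split.
- by rewrite coprimep_div_gcd // q0 orbT.
- rewrite -{1}dp -{3}dq !rmorphM /= -mulf_div divff ?mulr1 //.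
  by rewrite tofrac_eq0.
- by apply: contra q_a; rewrite -[X in _ -> is_true (root X _)]dq rootM => ->.
Qed.

Lemma regular_poly (p : {poly C}) : regular_at p%:F.
Proof. by exists p, 1; rewrite rmorph1 divr1 root1. Qed.

Lemma regular_inv (q : {poly C}) : ~~ root q a -> regular_at (q%:F)^-1.
Proof. by move=> q_a; exists 1, q; rewrite rmorph1 mul1r. Qed.

Lemma regularD r s : regular_at r -> regular_at s -> regular_at (r + s).
Proof.
case=> p [q [-> q_a]] [p' [q' [-> q'_a]]].
exists (p * q' + p' * q), (q * q'); split; last by rewrite rootM negb_or q_a.
by rewrite rmorphD !rmorphM /= addf_div ?root_neq0.
Qed.

Lemma regularM r s : regular_at r -> regular_at s -> regular_at (r * s).
Proof.
case=> p [q [-> q_a]] [p' [q' [-> q'_a]]].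
exists (p * p'), (q * q'); split; last by rewrite rootM negb_or q_a.
by rewrite !rmorphM /= mulf_div.
Qed.

Lemma regular_nat n : regular_at n%:R.
Proof. by rewrite -(rmorph_nat (@FracField.tofrac _)); apply: regular_poly. Qed.

Lemma regular_sum (I : Type) (s : seq I) (P : pred I) F :
  (forall i, P i -> regular_at (F i)) -> regular_at (\sum_(i <- s | P i) F i).
Proof. by move=> regF; apply: big_ind => //; [apply: (regular_nat 0)|apply: regularD]. Qed.

Lemma regular_prod (I : Type) (s : seq I) (P : pred I) F :
  (forall i, P i -> regular_at (F i)) -> regular_at (\prod_(i <- s | P i) F i).
Proof. by move=> regF; apply: big_ind => //; [apply: (regular_nat 1)|apply: regularM]. Qed.

Lemma regular_mxexp m (A : 'M[K]_m.+1) n i k :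
  (forall i k, regular_at (A i k)) -> regular_at ((A ^+ n) i k).
Proof.
move=> regA; elim: n i k => [|n IHn] i k; first by rewrite mxE; apply: regular_nat.
by rewrite exprS mxE; apply: regular_sum => j _; apply: regularM.
Qed.

Lemma regular_sl2F m i k : regular_at (sl2F K m i k).
Proof.
rewrite mxE; case: ifP => _; last exact: (regular_nat 0).
rewrite -natrB; [exact: regular_nat | by rewrite -ltnS].
Qed.

Lemma regular_sl2E m i k : regular_at (sl2E K m i k).
Proof. by rewrite mxE; case: ifP => _; apply: (regular_nat _) || apply: (regular_nat 0). Qed.
End Regular.

(** * Supports of powers of F and E, and diagonal matrices *)

Lemma sl2F_exp_eq0 (K : fieldType) m n (i k : 'I_m.+1) :
  i != (k + n)%N :> nat -> (sl2F K m ^+ n) i k = 0.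
Proof.
elim: n i => [|n IHn] i neq_i.
  by rewrite mxE -val_eqE; move: neq_i; rewrite addn0 => /negPf ->.
rewrite exprS mxE big1 // => j _; rewrite mxE.
case: eqP => [eq_i|_]; last by rewrite mul0r.
by rewrite IHn ?mulr0 //; apply: contraNneq neq_i => eq_j; rewrite eq_i eq_j addnS.
Qed.

Lemma sl2E_exp_eq0 (K : fieldType) m n (i k : 'I_m.+1) :
  k != (i + n)%N :> nat -> (sl2E K m ^+ n) i k = 0.
Proof.
elim: n i => [|n IHn] i neq_k.
  by rewrite mxE -val_eqE eq_sym; move: neq_k; rewrite addn0 => /negPf ->.
rewrite exprS mxE big1 // => j _; rewrite mxE.
case: eqP => [eq_j|_]; last by rewrite mul0r.
by rewrite IHn ?mulr0 // eq_j addSnnS.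
Qed.

Lemma invmx_diag (K : fieldType) n (d : 'rV[K]_n) :
  (forall i, d 0 i != 0) -> invmx (diag_mx d) = diag_mx (\row_i (d 0 i)^-1).
Proof.
move=> d_neq0; set e := diag_mx (\row_i _).
have dK : diag_mx d *m e = 1%:M.
  rewrite mulmx_diag -diag_const_mx; congr diag_mx.
  by apply/rowP => i; rewrite !mxE divff.
have [d_unit _] := mulmx1_unit dK.
by rewrite -[e]mul1mx -(mulVmx d_unit) -mulmxA dK mulmx1.
Qed.

Lemma prod_diag_mx (K : comPzRingType) n (I : Type) (s : seq I) (d : I -> 'rV[K]_n) :
  \prod_(i <- s) diag_mx (d i) = diag_mx (\row_q \prod_(i <- s) d i 0 q).
Proof.
elim: s => [|i s IHs].
  rewrite big_nil -[LHS]diag_const_mx; congr diag_mx.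
  by apply/rowP => q; rewrite !mxE big_nil.
rewrite big_cons IHs -[LHS]/(_ *m _) mulmx_diag; congr diag_mx.
by apply/rowP => q; rewrite !mxE big_cons.
Qed.

(** * Entries of the inverse twist and cancellation of their poles *)

Section Entries.
Variables (C : numFieldType) (eta : C) (m1 m2 : nat).
Local Notation K := {fraction {poly C}}.

Definition lin (c : C) : K := ('X + (eta * c)%:P)%:F.

Lemma lin_neq0 c : lin c != 0.
Proof. by rewrite tofrac_eq0 -size_poly_eq0 size_XaddC. Qed.

Lemma linE c : lin c = 'X%:F + eta%:P%:F * c%:P%:F.
Proof. by rewrite /lin polyCM rmorphD rmorphM. Qed.

Lemma regular_lin a c : regular_at a (lin c).
Proof. exact: regular_poly. Qed.

Lemma regular_linV a c : a + eta * c != 0 -> regular_at a (lin c)^-1.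
Proof. by move=> ac; apply: regular_inv; rewrite rootE !hornerE. Qed.

Lemma spin_polyC m : spin K m = (spin C m)%:P%:F.
Proof.
pose iota : {rmorphism C -> K} := (@FracField.tofrac _ \o polyC)%FUN.
by rewrite -[RHS]/(iota _) /spin fmorph_div !rmorph_nat.
Qed.

Lemma nat_polyC n : n%:R = (n%:R : C)%:P%:F :> K.
Proof. by rewrite polyC_natr rmorph_nat. Qed.

Lemma Qinv_coefE l k :
  Qinv_coef eta m1 m2 l k =
    (\prod_(j < k) lin (spin C m1 - spin C m2 - l%:R + j%:R)) *
    (\prod_(j < k) (lin (- spin C m1 - spin C m2 + j%:R))^-1).
Proof.
rewrite -big_split /=; apply: eq_bigr => j _.
by rewrite !linE !(rmorphD, rmorphB, rmorphN) /= !spin_polyC -!nat_polyC.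
Qed.

Lemma Finv_factorE j :
  Finv_factor eta m1 m2 j = diag_mx (tens_row (fun l k =>
    lin (spin C m1 - spin C m2 - l%:R + k%:R - j%:R))).
Proof.
apply/matrixP => q q'; case: (mxtens_indexP q) => l k.
case: (mxtens_indexP q') => l' k'.
rewrite !mxE !mxtens_indexK /=.
have -> : (mxtens_index (l, k) == mxtens_index (l', k')) = (l == l') && (k == k').
  by rewrite (can_eq (@mxtens_indexK _ _)).
case: (l =P l') => [->|_] /=; last by rewrite !mul0r !mulr0n; ring.
case: (k =P k') => [->|_] /=; last by rewrite !mulr0 !mulr0n; ring.
rewrite linE !(rmorphD, rmorphB, rmorphN) /= -!spin_polyC -!nat_polyC; ring.
Qed.

Lemma Finv_entry i j :
  Finv eta m1 m2 i j =
  let: (l', k') := mxtens_unindex i in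
  let: (l, k) := mxtens_unindex j in
  \sum_(n < m2.+1) (- eta%:P%:F) ^+ n / n`!%:R *
    (((sl2F K m1 ^+ n) l' l * (sl2E K m2 ^+ n) k' k) *
     \prod_(1 <= p < n.+1) (lin (spin C m1 - spin C m2 - l%:R + k%:R - p%:R))^-1) *
    Qinv_coef eta m1 m2 l k.
Proof.
case: (mxtens_indexP i) => l' k'; case: (mxtens_indexP j) => l k.
rewrite !mxtens_indexK /Finv mul_mx_diag !mxE summxE mulr_suml mxtens_indexK /=.
apply: eq_bigr => n _; congr (_ * _); rewrite mxE; congr (_ * _).
under eq_bigr => p _.
  rewrite Finv_factorE invmx_diag; last by move=> q; rewrite mxE lin_neq0.
  over.
rewrite prod_diag_mx mul_mx_diag [LHS]mxE tensmxE [X in _ * X]mxE; congr (_ * _).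
by apply: eq_bigr => p _; rewrite mxE tens_rowE.
Qed.

Lemma prod_lin_telescope c m k n : m = (k + n)%N ->
  (\prod_(1 <= p < n.+1) (lin (c + m%:R - p%:R))^-1) *
    \prod_(j < m) lin (c + j%:R) = \prod_(j < k) lin (c + j%:R).
Proof.
move=> ->.
rewrite big_split_ord /= mulrCA -[RHS]mulr1; congr (_ * _).
(* Reversal pairs the Cartan factor [p = n - j] with the numerator factor of index [k + j]. *)
rewrite big_add1 big_nat_rev big_mkord -big_split big1 //= => j _.
have -> : c + (k + n)%:R - (0 + n - j.+1).+1%:R = c + (k + j)%:R.
  have -> : (k + n)%N = ((k + j) + (0 + n - j.+1).+1)%N by have := ltn_ord j; lia.
  by rewrite natrD addrA addrK.
by rewrite mulVf ?lin_neq0.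
Qed.

Variable a : C.
Hypotheses (eta_neq0 : eta != 0)
  (a_neq : forall j, (j < m1)%N -> (j < m2)%N ->
    a != eta * (spin C m1 + spin C m2 - j%:R)).

(** At most one denominator factor vanishes at [a]. Its index [j0] is below [m2], so [a_neq] forces
    [m1 <= j0], and then the same linear factor occurs in the numerator. *)
Lemma regular_lin_ratio l k k' :
  (k <= m2)%N -> (k' <= k)%N -> (l + (k - k') <= m1)%N ->
  regular_at a
    ((\prod_(j < k') lin (spin C m1 - spin C m2 - l%:R + j%:R)) *
     (\prod_(j < k) (lin (- spin C m1 - spin C m2 + j%:R))^-1)).
Proof.
move=> le_km2 le_k'k le_lm1.
pose b j : C := a + eta * (- spin C m1 - spin C m2 + j%:R).
have bE j : (b j == 0) = (a == eta * (spin C m1 + spin C m2 - j%:R)).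
  by rewrite -[RHS]subr_eq0; congr (_ == 0); rewrite /b; ring.
case: (pickP (fun j : 'I_k => b j == 0)) => [j0 bj0|b_neq0]; last first.
  apply: regularM; apply: regular_prod => j _; first exact: regular_lin.
  by apply: regular_linV; rewrite -/(b j) b_neq0.
have le_m1j0 : (m1 <= j0)%N.
  rewrite leqNgt; apply: contraTN bj0 => lt_j0; rewrite bE a_neq //.
  exact: leq_trans (ltn_ord j0) le_km2.
(* This index solves lambda1 - lambda2 - l + j = - lambda1 - lambda2 + j0, as m1 = 2 lambda1. It is
   below [k'] because [j0 < k] and [l + (k - k') <= m1]. *)
have lt_j1 : (j0 + l - m1 < k')%N by have := ltn_ord j0; lia.
rewrite (bigD1 (Ordinal lt_j1)) //= (bigD1 j0) //=.
have -> : spin C m1 - spin C m2 - l%:R + (j0 + l - m1)%:R =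
    - spin C m1 - spin C m2 + j0%:R.
  rewrite natrB ?natrD; last exact: leq_trans le_m1j0 (leq_addr _ _).
  by rewrite (spin2 C m1); ring.
rewrite mulrACA divff ?lin_neq0 // mul1r.
apply: regularM; apply: regular_prod => j neq_j; first exact: regular_lin.
(* [b] is injective, as [eta] is nonzero and the characteristic is zero; hence no other denominator
   vanishes. *)
apply: regular_linV; rewrite -/(b j) -(eqP bj0) /b.
rewrite (inj_eq (addrI _)) (inj_eq (mulfI eta_neq0)) (inj_eq (addrI _)).
by rewrite eqr_nat val_eqE.
Qed.

Lemma Finv_regular i j : regular_at a (Finv eta m1 m2 i j).
Proof.
rewrite Finv_entry; case: (mxtens_unindex i) => l' k'.
case: (mxtens_unindex j) => l k; apply: regular_sum => n _.
(* A term survives only if [n = l' - l = k - k']. *)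
have [eq_l|neq_l] := eqVneq (l' : nat) (l + n)%N; last first.
  by rewrite (sl2F_exp_eq0 _ neq_l) !(mul0r, mulr0); apply: (regular_nat a 0).
have [eq_k|neq_k] := eqVneq (k : nat) (k' + n)%N; last first.
  by rewrite (sl2E_exp_eq0 _ neq_k) !(mul0r, mulr0); apply: (regular_nat a 0).
rewrite Qinv_coefE -!mulrA; apply: regularM.
  by rewrite -tofracN -tofracXn; apply: regular_poly.
apply: regularM.
  rewrite nat_polyC; apply: regular_inv.
  by rewrite rootC pnatr_eq0 -lt0n fact_gt0.
apply: regularM; first by apply: regular_mxexp => *; apply: regular_sl2F.
apply: regularM; first by apply: regular_mxexp => *; apply: regular_sl2E.
rewrite mulrA (prod_lin_telescope _ eq_k); apply: regular_lin_ratio.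
- by rewrite -ltnS.
- by rewrite eq_k leq_addr.
(* The bound [l + n <= m1] holds because [l + n] is the basis index [l']; this is where F^n|l> being
   nonzero enters. *)
- by rewrite eq_k addKn -eq_l -ltnS.
Qed.
End Entries.

Unset Implicit Arguments.

Theorem proposition5p3 (R : realType) (eta : R[i]) (heta : eta != 0)
    (m1 m2 : nat) (delta1 delta2 : R[i])
    (hirr : yangian_irreducible eta m1 m2 delta1 delta2) :
  forall i j : 'I_(m1.+1 * m2.+1),
    no_pole (Finv eta m1 m2 i j) (delta1 - delta2).
Proof.
move=> i j; apply: regular_no_pole; apply: Finv_regular heta _ i j => p lt_m1 lt_m2.
exact: irreducible_neq hirr lt_m1 lt_m2.
Qed.
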